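(* Let $1\le k\le n$, let $X_1,\ldots,X_n,Z$ have an arbitrary joint distribution (not necessarily discrete or continuous), and let $t\in\mathbb R$ be such that $P(X_{1:n}>t)>0$. Let $(X_1^{(t)},\ldots,X_n^{(t)},Z^{(t)})$ be a random vector with reliability function $$P(X_1^{(t)}>x_1,\ldots,X_n^{(t)}>x_n,Z^{(t)}>z)=\frac{P(X_1>\max(t,x_1+t),\ldots,X_n>\max(t,x_n+t),Z>z)}{P(X_1>t,\ldots,X_n>t)},\quad x_1,\ldots,x_n,z\in\mathbb R.$$ Let $T$ and $T^{(t)}$ be the lifetimes of $k$-out-of-$n$ systems with one cold standby unit each and with element lifetimes $X_1,\ldots,X_n,Z$ and $X_1^{(t)},\ldots,X_n^{(t)},Z^{(t)}$, respectively. Then the conditional distribution of $T-t$ given $X_{1:n}>t$ is the same as the unconditional distribution of $T^{(t)}$. In particular, $$P(T-t>s\mid X_{1:n}>t)=P(T^{(t)}>s),\quad s\ge0,$$ and $E(T-t\mid X_{1:n}>t)=E\,T^{(t)}$ (whenever one of these expectations is well defined). Moreover, if $X_1,\ldots,X_n,Z$ are independent with $\bar F_i(x)=P(X_i>x)$, then one may take $(X_1^{(t)},\ldots,X_n^{(t)},Z^{(t)})=(X_1^{(t)},\ldots,X_n^{(t)},Z)$, where $X_1^{(t)},\ldots,X_n^{(t)},Z$ are independent and $$P(X_i^{(t)}>x)=P(X_i>x+t\mid X_i>t)=\begin{cases}\dfrac{\bar F_i(x+t)}{\bar F_i(t)}&\text{if }x>0,\\ 1&\text{otherwise,}\end{cases}\qquad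 i=1,\ldots,n.$$
   Context: For random variables $W_1,\ldots,W_n$, $W_{1:n}\le\cdots\le W_{n:n}$ denote their order statistics, and $W_{n+1:n}:=\infty$. The lifetime of the $k$-out-of-$n$ system with active component lifetimes $W_1,\ldots,W_n$ and one cold standby unit with lifetime $V$ is $\min(W_{n-k+1:n}+V,\,W_{n-k+2:n})$ (which is $W_{n:n}+V$ when $k=1$). Thus $T=\min(X_{n-k+1:n}+Z,X_{n-k+2:n})$ and $T^{(t)}=\min(X^{(t)}_{n-k+1:n}+Z^{(t)},X^{(t)}_{n-k+2:n})$. *)

(* Defs.v *)
From mathcomp Require Import all_boot all_order all_algebra.
From mathcomp Require Import all_classical all_reals all_analysis.

Set Implicit Arguments.
Unset Strict Implicit.
Unset Printing Implicit Defensive.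

Import Order.TTheory GRing.Theory Num.Theory.
Import numFieldNormedType.Exports.

Local Open Scope classical_set_scope.
Local Open Scope ring_scope.

Section OrderStatistics.
Context {R : realType} {n : nat}.
Implicit Types (W : 'I_n -> R) (V : R) (j k : nat).

(* The j-th smallest value for 1 <= j <= n; the default value of nth gives the
   convention that the order statistic of rank n.+1 is +oo. *)
Definition order_stat W j : \bar R :=
  nth +oo%E (sort <=%O [seq (W i)%:E | i <- enum 'I_n]) j.-1.

(* The minimum is a real number as soon as 1 <= k <= n, see lifetimeE. *)
Definition lifetime k W V : R :=
  fine (Order.min (order_stat W (n - k + 1) + V%:E) (order_stat W (n - k + 2)))%E.

Lemma order_stat_ninfty W j : (order_stat W j != -oo)%E.
Proof.
rewrite /order_stat; set s := sort _ _.
have [js|/(nth_default +oo%E) ->//] := ltnP j.-1 (size s).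
have := mem_nth +oo%E js; rewrite mem_sort => /mapP[i _ ->].
by [].
Qed.

Lemma order_stat_fin W j : (1 <= j <= n)%N -> order_stat W j \is a fin_num.
Proof.
move=> /andP[j1 jn]; rewrite /order_stat; set s := sort _ _.
have js : (j.-1 < size s)%N.
  by rewrite size_sort size_map size_enum_ord prednK.
by have := mem_nth +oo%E js; rewrite mem_sort => /mapP[i _ ->].
Qed.

Lemma order_stat_infty W : order_stat W n.+1 = +oo%E.
Proof. by rewrite /order_stat nth_default// size_sort size_map size_enum_ord. Qed.

Lemma lifetimeE k W V : (1 <= k <= n)%N ->
  (lifetime k W V)%:E =
  Order.min (order_stat W (n - k + 1) + V%:E)%E (order_stat W (n - k + 2)).
Proof.
move=> /andP[k1 kn].
have ok : (1 <= n - k + 1 <= n)%N.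
  by rewrite addn1 ltnS leq0n /= -subSn// leq_subLR -add1n leq_add2r.
rewrite /lifetime fineK//; have := order_stat_fin W ok.
have := order_stat_ninfty W (n - k + 2).
rewrite minEle; case: ifP => // [_ _|h].
  by rewrite fin_numD => ->.
move=> oN /fineK oF; rewrite fin_numE oN /=; apply/eqP => oy.
by move: h; rewrite oy leey.
Qed.

Lemma lifetime1E W V : (1 <= n)%N ->
  (lifetime 1 W V)%:E = (order_stat W n + V%:E)%E.
Proof.
move=> n1; rewrite lifetimeE ?n1// subnK// addn2 -subSn// subn1.
by rewrite order_stat_infty minEle leey.
Qed.

End OrderStatistics.

Section Probability.
Local Open Scope ereal_scope.
Context {d : measure_display} {T : measurableType d} {R : realType}.
Implicit Types (P : probability T R) (A B : set T).

(* P(B | A) *)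
Definition cond_prob P B A : \bar R := P (B `&` A) / P A.

(* E(Y | A) *)
Definition cond_expectation P (Y : T -> R) A : \bar R :=
  (\int[P]_(w in A) (Y w)%:E) / P A.

(* The integral of Y over A exists in the extended reals: it is not of the
   form +oo - +oo. *)
Definition integral_defined P (Y : T -> R) A : Prop :=
  \int[P]_(w in A) (EFin \o Y)^\+ w < +oo \/
  \int[P]_(w in A) (EFin \o Y)^\- w < +oo.

Definition mutually_independent P (I : finType) (Y : I -> {RV P >-> R}) : Prop :=
  forall (J : {set I}) (B : I -> set R), (forall i, measurable (B i)) ->
    P [set w | forall i, i \in J -> B i (Y i w)] =
    \prod_(i in J) P (Y i @^-1` B i).

(* The family X_1, ..., X_n, Z; None is the index of Z. *)
Definition adjoin P n (X : 'I_n -> {RV P >-> R}) (Z : {RV P >-> R})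
  (o : option 'I_n) : {RV P >-> R} := if o is Some i then X i else Z.

Definition reliability P n (X : 'I_n -> {RV P >-> R}) (Z : {RV P >-> R})
    (x : 'I_n -> R) (z : R) : \bar R :=
  P [set w | (forall i, x i < X i w)%R /\ (z < Z w)%R].

End Probability.

Definition has_residual_reliability {R : realType} n (t : R)
    d (T : measurableType d) (P : probability T R)
    (X : 'I_n -> {RV P >-> R}) (Z : {RV P >-> R})
    d' (T' : measurableType d') (P' : probability T' R)
    (Xt : 'I_n -> {RV P' >-> R}) (Zt : {RV P' >-> R}) : Prop :=
  forall (x : 'I_n -> R) (z : R),
    reliability Xt Zt x z =
    (reliability X Z (fun i => Num.max t (x i + t)%R) z /
     P [set w | forall i, (t < X i w)%R])%E.

(* Main.v *)
(* The orthants {u | u_1 > x_1, ..., u_n > x_n, v > z} form a pi-system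
   generating the Borel sets, so the hypothesis on the reliability functions says
   that (X^(t), Z^(t)) has the law of (X_1 - t, ..., X_n - t, Z) under
   P(. | X_{1:n} > t).  The lifetime is a measurable function of its arguments
   and commutes with a common shift of the active lifetimes; the expectations
   follow by integrating positive and negative parts against the common law. *)
Require Import Defs.
From mathcomp Require Import all_boot all_order all_algebra.
From mathcomp Require Import all_classical all_reals all_analysis.
From mathcomp Require Import measurable_realfun.

Set Implicit Arguments.
Unset Strict Implicit.
Unset Printing Implicit Defensive.

Import Order.TTheory GRing.Theory Num.Theory.
Import numFieldNormedType.Exports.

Local Open Scope classical_set_scope.
Local Open Scope ring_scope.

(** * Order statistics: comparison by counting, and shifts *)

(** In a sorted list the entries at most [c] form an initial segment, so index [m] lies beyond it
    exactly when the segment has length at most [m]. An index past the end reads [+oo], which agrees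
    with this count. *)
Lemma lt_nth_sorted (R : realDomainType) (s : seq \bar R) (c : R) (m : nat) :
  sorted <=%O s ->
  (c%:E < nth +oo s m)%E = (count (fun x => x <= c%:E)%E s <= m)%N.
Proof.
elim: s m => [|x s IH] m /=; first by rewrite nth_nil ltry.
move=> xs; have ss := path_sorted xs.
(* Once the head exceeds [c], sortedness leaves nothing to count in the tail. *)
have s0 : (c%:E < x)%E -> count (fun y => y <= c%:E)%E s = 0%N.
  move=> cx; apply/eqP; rewrite eqn0Ngt -has_count -all_predC.
  apply/allP => y ys /=; rewrite -ltNge (lt_le_trans cx)//.
  exact: (allP (order_path_min le_trans xs)).
case: m => [|m] /=; last rewrite IH//.
  by case: ltP => [/s0 ->|].
by case: ltP => [/s0 ->|].
Qed.

Section OrderStatistics.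
Context {R : realType} {n : nat}.
Implicit Types (W : 'I_n -> R) (V : R) (j k : nat).

(** Counting the values at most [c] avoids choosing a sorting permutation, so ties need no separate
    treatment. The predecessor turns the rank into a list index. *)
Lemma order_stat_gt W j (c : R) :
  (c%:E < order_stat W j)%E = (#|[set i | (W i <= c)%R]%SET| <= j.-1)%N.
Proof.
rewrite /order_stat lt_nth_sorted; last by apply: sort_sorted; exact: le_total.
rewrite count_sort count_map -sum1_count big_enum_cond cardsE -sum1_card.
by congr (_ <= _)%N.
Qed.

Lemma order_stat1_gt W (c : R) :
  (c%:E < order_stat W 1)%E <-> forall i, c < W i.
Proof.
rewrite order_stat_gt leqn0 cards_eq0; split => [/eqP W0 i|cW].
  by have /finset.setP/(_ i) := W0; rewrite !inE ltNge => ->.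
by apply/eqP/finset.setP => i; rewrite !inE leNgt cW.
Qed.

Lemma order_statB W (t : R) j :
  order_stat (fun i => W i - t) j = (order_stat W j - t%:E)%E.
Proof.
rewrite /order_stat; set s := [seq (W i)%:E | i <- _].
have -> : [seq (W i - t)%:E | i <- enum 'I_n] = [seq (x - t%:E)%E | x <- s].
  by rewrite -[RHS]map_comp.
(* Subtracting a real preserves and reflects the order, hence commutes with sorting. *)
rewrite -(map_sort (leT' := <=%O)); last first.
  by move=> x y; exact: leeD2rE.
have [js|js] := ltnP j.-1 (size (sort <=%O s)); first exact: nth_map.
(* Beyond the last rank both sides are [+oo], which absorbs the finite shift. *)
by rewrite !nth_default// size_map.
Qed.

(** Only the active lifetimes are shifted: both arguments of the minimum contain exactly one order
    statistic, so each moves by [t] while [V] stays fixed. *)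
Lemma lifetimeB k W V (t : R) : (1 <= k <= n)%N ->
  lifetime k (fun i => W i - t) V = lifetime k W V - t.
Proof.
move=> hk; apply: EFin_inj; rewrite EFinB !lifetimeE// !order_statB.
rewrite addeAC !minEle leeD2rE//. by case: ifP.
Qed.

End OrderStatistics.

(** * Measurability of the order statistics and of the lifetime *)

Lemma measurable_forall d (T : measurableType d) (I : finType) (F : I -> set T) :
  (forall i, measurable (F i)) -> measurable [set w | forall i, F i w].
Proof.
move=> mF; rewrite [X in measurable X](_ : _ = \bigcap_i F i).
  by apply: fin_bigcap_measurable => //; exact: finite_finset.
by apply/seteqP; split => w /= Fw i; [move=> _|]; exact: Fw.
Qed.

Section Measurability.
Context {R : realType} {d : measure_display} {T : measurableType d} {n : nat}.
Variables (W : 'I_n -> T -> R) (V : T -> R).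
Hypothesis mW : forall i, measurable_fun setT (W i).
Hypothesis mV : measurable_fun setT V.

Lemma measurable_gt (f : T -> R) c : measurable_fun setT f ->
  measurable [set w | c < f w].
Proof.
move=> mf; rewrite -[X in measurable X]setTI.
have -> : [set w | c < f w] = f @^-1` `]c, +oo[.
  by apply/seteqP; split => w /=; rewrite in_itv/= andbT.
exact: mf.
Qed.

Lemma measurable_all_gt c : measurable [set w | forall i, c < W i w].
Proof.
apply: (measurable_forall (F := fun i => [set w | c < W i w])) => i; exact: measurable_gt.
Qed.

Lemma measurable_order_stat j :
  measurable_fun setT (fun w => order_stat (W^~ w) j).
Proof.
apply: (measurability _ (ErealGenOInfty.measurableE R)).
move=> _ [_ [c ->] <-]; rewrite setTI.
(* By the counting criterion, the event is a finite union over the sets [S] of fewer than [j]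
   indices (at most none when [j] is 0) outside which all values exceed [c]. *)
rewrite [X in measurable X](_ : _ =
    \bigcup_(S in [set S : {set 'I_n} | (#|S| <= j.-1)%N])
    \bigcap_(i in [set i | i \notin S]) [set w | c < W i w]).
  apply: fin_bigcup_measurable; first exact: finite_finset.
  move=> S _; apply: fin_bigcap_measurable; first exact: finite_finset.
  by move=> i _; exact: measurable_gt.
apply/seteqP; split => w /=; rewrite in_itv/= andbT order_stat_gt.
  by move=> Sj; exists [set i | (W i w <= c)%R]%SET => // i /=; rewrite inE -ltNge.
move=> [S /= Sj Sc]; apply: leq_trans Sj; apply: subset_leq_card.
apply/fintype.subsetP => i; rewrite inE; apply: contraTT => /Sc /=.
by rewrite -ltNge.
Qed.

Lemma measurable_lifetime k :
  measurable_fun setT (fun w => lifetime k (W^~ w) (V w)).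
Proof.
apply: measurableT_comp; first exact: fine_measurable.
apply: measurable_mine; last exact: measurable_order_stat.
apply: emeasurable_funD; first exact: measurable_order_stat.
exact/measurable_EFinP.
Qed.

End Measurability.

(** * Conditioning on an event as a probability measure *)

Section ConditionalMeasure.
Local Open Scope ereal_scope.
Context {R : realType} {d : measure_display} {T : measurableType d}.
Variables (P : probability T R) (A : set T).
Hypotheses (mA : measurable A) (PA : 0 < P A).

(** The second [P] is the default of [mnormalize] for a restriction of zero or infinite mass; the
    hypothesis [PA] excludes that case in the lemmas below. Bundling the result as a probability
    makes conditional laws instances of results about laws. *)
Definition cond_measure : probability T R := mnormalize (mrestr P mA) P.

Lemma cond_measureE U : cond_measure U = cond_prob P U A.
Proof.
have PAf : P A \is a fin_num by exact: fin_num_measure.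
have PA0 : fine (P A) != 0%R by rewrite gt_eqF// fine_gt0// PA ltey_eq PAf.
have PT : (mrestr P mA : measure T R) setT = P A.
  by rewrite -[LHS]/(P (setT `&` A)) setTI.
rewrite /cond_measure /= /mnormalize PT gt_eqF//= -[in LHS](fineK PAf) /=.
by rewrite /mrestr /cond_prob -[in RHS](fineK PAf) inver (negbTE PA0).
Qed.

Lemma ge0_integral_cond_measure (f : T -> \bar R) :
  measurable_fun setT f -> (forall w, 0 <= f w) ->
  \int[P]_(w in A) f w = P A * \int[cond_measure]_w f w.
Proof.
move=> mf f0; have PAf : P A \is a fin_num by exact: fin_num_measure.
have PAr : (0 <= fine (P A))%R by exact: fine_ge0.
have mfA : measurable_fun A f by exact: measurable_funS mf.
(* On measurable subsets of [A], [P] is [P A] times the conditional measure. *)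
rewrite (eq_measure_integral (mscale (NngNum PAr) cond_measure)); last first.
  move=> U mU UA; rewrite -[RHS]/((fine (P A))%:E * cond_measure U) fineK//.
  rewrite cond_measureE /cond_prob (setIidl UA).
  by rewrite muleCA divee ?mule1// gt_eqF.
rewrite ge0_integral_mscale//; congr (_ * _); first exact: fineK.
(* The complement of [A] is null for the conditional measure, so the integral over the whole space
   reduces to one over [A]. *)
rewrite [RHS](@ge0_negligible_integral _ _ _ _ setT (~` A))//.
- by rewrite setTD setCK.
- exact: measurableC.
- rewrite -[LHS]/(cond_measure (~` A)) cond_measureE /cond_prob.
  by rewrite setICl measure0 mul0e.
Qed.

End ConditionalMeasure.

(** * Joint laws determined by reliability functions *)

Section JointLaw.
Context {R : realType} {n : nat}.

Definition orthant (x : ('I_n -> R) * R) : set (('I_n -> R) * R) :=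
  [set u | (forall i, x.1 i < u.1 i) /\ x.2 < u.2].

Definition orthants : set (set (('I_n -> R) * R)) := range orthant.

Lemma orthantsI : setI_closed orthants.
Proof.
move=> _ _ [x _ <-] [y _ <-].
exists (fun i => Num.max (x.1 i) (y.1 i), Num.max x.2 y.2) => //.
apply/seteqP; split => u /=.
  move=> [/= xyu]; rewrite gt_max => /andP[x2 y2].
  by split; split => // i; have := xyu i; rewrite gt_max => /andP[].
move=> [[xu x2] [yu y2]]; split => [i|] /=; rewrite gt_max ?x2 ?y2//.
by rewrite xu yu.
Qed.

(** Despite the name, this is an unbounded orthant with corner tending to minus infinity. These sets
    provide the exhaustion by generators of finite mass required for uniqueness of measures. *)
Definition cube (m : nat) := orthant (fun=> - m%:R, - m%:R).

Lemma bigcup_cube : \bigcup_m cube m = setT.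
Proof.
apply/seteqP; split => // u _.
(* The sum of absolute values dominates every coordinate, so a single natural number above it serves
   all of them. *)
pose b := \sum_i `|u.1 i| + `|u.2|.
have b0 : 0 <= b by rewrite addr_ge0// sumr_ge0.
exists (Num.bound b) => //=; have ltb := archi_boundP b0.
have h v : `|v| <= b -> - (Num.bound b)%:R < v.
  move=> vb; rewrite ltrNl (le_lt_trans _ ltb)// (le_trans _ vb)//.
  by rewrite -normrN ler_norm.
split=> [i|] /=; apply: h; last by rewrite lerDr sumr_ge0.
by rewrite /b (bigD1 i)//= -addrA lerDl addr_ge0// sumr_ge0.
Qed.

(** The sigma-algebra is by definition the one generated by the orthants, so uniqueness of measures
    applies directly; the coordinates are then shown measurable for it. *)
Local Notation vec := (g_sigma_algebraType orthants).

Lemma measurable_orthant x : measurable (orthant x : set vec).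
Proof. by apply: sub_sigma_algebra; exists x. Qed.

Lemma measurable_coord (i : 'I_n) : measurable_fun setT (fun u : vec => u.1 i).
Proof.
apply: (measurability _ (RGenOInfty.measurableE R)).
move=> _ [_ [c ->] <-]; rewrite setTI.
(* A half-space is the union of orthants whose other corner coordinates go to minus infinity. *)
rewrite [X in measurable X](_ : _ = \bigcup_m
    (orthant (fun j => if j == i then c else - m%:R, - m%:R))).
  by apply: bigcupT_measurable => m; exact: measurable_orthant.
apply/seteqP; split => u /=; rewrite in_itv/= andbT.
  have [m _ [mu mu2] cu] : (\bigcup_m cube m) u by rewrite bigcup_cube.
  by exists m => //; split=> // j /=; case: eqP => [->//|_]; exact: mu.
by move=> [m _ [/(_ i)/=]]; rewrite eqxx.
Qed.

Lemma measurable_last : measurable_fun setT (fun u : vec => u.2).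
Proof.
apply: (measurability _ (RGenOInfty.measurableE R)).
move=> _ [_ [c ->] <-]; rewrite setTI.
rewrite [X in measurable X](_ : _ = \bigcup_m (orthant (fun=> - m%:R, c))).
  by apply: bigcupT_measurable => m; exact: measurable_orthant.
apply/seteqP; split => u /=; rewrite in_itv/= andbT.
  have [m _ [mu mu2] cu] : (\bigcup_m cube m) u by rewrite bigcup_cube.
  by exists m.
by move=> [m _ []].
Qed.

Lemma measurable_vec d (T : measurableType d) (X : 'I_n -> T -> R) (Z : T -> R) :
  (forall i, measurable_fun setT (X i)) -> measurable_fun setT Z ->
  measurable_fun setT (fun w => (X^~ w, Z w) : vec).
Proof.
move=> mX mZ; apply: (@measurability _ _ T vec setT _ orthants) => // _ [_ [x _ <-] <-].
rewrite setTI [X in measurable X](_ : _ =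
    [set w | forall i, x.1 i < X i w] `&` [set w | x.2 < Z w]) //.
apply: measurableI; last exact: measurable_gt.
apply: (measurable_forall (F := fun i => [set w | x.1 i < X i w])) => i.
exact: measurable_gt.
Qed.

Context d (T : measurableType d) (P : probability T R)
  d' (T' : measurableType d') (P' : probability T' R).
Variables (X : 'I_n -> T -> R) (Z : T -> R) (X' : 'I_n -> T' -> R) (Z' : T' -> R).
Hypotheses (mX : forall i, measurable_fun setT (X i)) (mZ : measurable_fun setT Z)
  (mX' : forall i, measurable_fun setT (X' i)) (mZ' : measurable_fun setT Z').
Hypothesis eqP : forall x z, P [set w | (forall i, x i < X i w) /\ z < Z w] =
  P' [set w | (forall i, x i < X' i w) /\ z < Z' w].

(** The two image laws on [vec] are finite and agree on the pi-system of orthants, hence on the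
    sigma-algebra it generates. *)
Lemma eq_joint_law (C : set vec) : measurable C ->
  P [set w | C (X^~ w, Z w)] = P' [set w | C (X'^~ w, Z' w)].
Proof.
pose f : {mfun T >-> vec} := mfun_Sub (mem_set (measurable_vec mX mZ)).
pose f' : {mfun T' >-> vec} := mfun_Sub (mem_set (measurable_vec mX' mZ')).
rewrite -[measurable C]/(<<s orthants >> C) -[LHS]/(distribution P f C).
rewrite -[RHS]/(distribution P' f' C); move: C.
apply: (@g_sigma_algebra_measure_unique _ _ vec orthants _ cube _ bigcup_cube
   (distribution P f) (distribution P' f') orthantsI) => //.
- by move=> _ [x _ <-]; exact: measurable_orthant.
- by move=> m; exists (fun=> - m%:R, - m%:R).
- by move=> _ [x _ <-]; exact: eqP.
- by move=> m; rewrite -ge0_fin_numE// fin_num_measure//; exact: measurable_orthant.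
Qed.

Lemma eq_law_lifetime k (B : set R) : measurable B ->
  P [set w | B (lifetime k (X^~ w) (Z w))] =
  P' [set w | B (lifetime k (X'^~ w) (Z' w))].
Proof.
move=> mB; apply: (@eq_joint_law (fun u => B (lifetime k u.1 u.2))).
rewrite -[X in measurable X]setTI.
(* Here [vec] itself is the sample space, with the coordinate maps as component lifetimes. *)
by apply: (measurable_lifetime measurable_coord measurable_last).
Qed.

End JointLaw.

(** * Transfer of integrals and expectations between equal laws *)

Lemma ge0_integral_eq_law (R : realType) d (T : measurableType d) (P : measure T R)
    d' (T' : measurableType d') (P' : measure T' R)
    (Y : T -> R) (Y' : T' -> R) (f : R -> \bar R) :
  measurable_fun setT Y -> measurable_fun setT Y' ->
  (forall B, measurable B -> P (Y @^-1` B) = P' (Y' @^-1` B)) ->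
  measurable_fun setT f -> (forall y, 0 <= f y)%E ->
  (\int[P]_w f (Y w) = \int[P']_w f (Y' w))%E.
Proof.
move=> mY mY' YY' mf f0.
rewrite -[LHS](ge0_integral_pushforward mY P measurableT)//.
rewrite -[RHS](ge0_integral_pushforward mY' P' measurableT)//.
by apply: eq_measure_integral => B mB _; exact: YY'.
Qed.

Section ConditionalExpectation.
Local Open Scope ereal_scope.
Context {R : realType} d (T : measurableType d) (P : probability T R)
  d' (T' : measurableType d') (P' : probability T' R).
Variables (A : set T) (Y : T -> R) (Y' : T' -> R).
Hypotheses (mA : measurable A) (PA : 0 < P A)
  (mY : measurable_fun setT Y) (mY' : measurable_fun setT Y').
Hypothesis YY' : forall B, measurable B ->
  cond_prob P (Y @^-1` B) A = P' (Y' @^-1` B).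

Lemma ge0_integral_cond_eq_law (f : R -> \bar R) :
  measurable_fun setT f -> (forall y, 0 <= f y) ->
  \int[P]_(w in A) f (Y w) = P A * \int[P']_w f (Y' w).
Proof.
move=> mf f0; rewrite (ge0_integral_cond_measure mA PA)//; last first.
  exact: measurableT_comp.
congr (_ * _); apply: ge0_integral_eq_law => // B mB.
by rewrite -[LHS]/(cond_measure P mA (Y @^-1` B)) (cond_measureE mA PA) YY'.
Qed.

(** The integrals of the positive and of the negative part each acquire the same factor [P A], which
    is positive and finite: it preserves finiteness in both directions and cancels in the
    conditional expectation. *)
Lemma cond_expectation_eq_law :
  integral_defined P Y A \/ integral_defined P' Y' setT ->
  [/\ integral_defined P Y A, integral_defined P' Y' setT &
      cond_expectation P Y A = 'E_P'[Y']].
Proof.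
have PAf : P A \is a fin_num by exact: fin_num_measure.
have ltPA x : (P A * x < +oo) = (x < +oo).
  by rewrite -[in LHS](gt0_muley PA) lte_pmul2l.
have pos : \int[P]_(w in A) (EFin \o Y)^\+ w = P A * \int[P']_w (EFin \o Y')^\+ w.
  rewrite (funepos_comp EFin Y) (funepos_comp EFin Y').
  rewrite (@ge0_integral_cond_eq_law EFin^\+)//.
  by apply: measurable_funepos; exact: EFin_measurable.
have neg : \int[P]_(w in A) (EFin \o Y)^\- w = P A * \int[P']_w (EFin \o Y')^\- w.
  rewrite (funeneg_comp EFin Y) (funeneg_comp EFin Y').
  rewrite (@ge0_integral_cond_eq_law EFin^\-)//.
  by apply: measurable_funeneg; exact: EFin_measurable.
have defE : integral_defined P Y A <-> integral_defined P' Y' setT.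
  by rewrite /integral_defined pos neg !ltPA.
move=> h; have h' : integral_defined P' Y' setT by case: h => // /defE.
split; [exact/defE|exact: h'|].
rewrite /cond_expectation expectation.unlock.
rewrite -[\int[P]_(w in A) _]/(\int[P]_(w in A) (EFin \o Y) w) integralE pos neg.
rewrite -[RHS]/(\int[P']_w (EFin \o Y') w) [RHS]integralE.
have p0 : 0 <= \int[P']_w (EFin \o Y')^\+ w by exact: integral_ge0.
have n0 : 0 <= \int[P']_w (EFin \o Y')^\- w by exact: integral_ge0.
(* Distributivity in the extended reals needs a well-defined difference; the two cases of [h']
   supply a finite positive or negative part. *)
rewrite -muleBr//; first by rewrite muleAC divee ?mul1e// gt_eqF.
case: h' => ?; first by rewrite fin_num_adde_defr// ge0_fin_numE.
by rewrite fin_num_adde_defl// fin_numN ge0_fin_numE.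
Qed.

End ConditionalExpectation.

(** * Law of the residual system lifetime *)

(** Given survival past [t], the vector of the [X i - t] and [Z] has the prescribed reliability
    function: [x i < X i - t] together with [t < X i] says that [X i] exceeds the maximum of [t] and
    [x i + t]. Equality of joint laws then passes to the lifetimes. *)
Lemma has_residual_reliability_lifetime (R : realType) n k (t : R)
    d (T : measurableType d) (P : probability T R)
    (X : 'I_n -> {RV P >-> R}) (Z : {RV P >-> R})
    d' (T' : measurableType d') (P' : probability T' R)
    (Xt : 'I_n -> {RV P' >-> R}) (Zt : {RV P' >-> R}) (B : set R) :
  (1 <= k <= n)%N -> (0 < P [set w | forall i, (t < X i w)%R])%E ->
  has_residual_reliability t X Z Xt Zt -> measurable B ->
  cond_prob P [set w | B (lifetime k (X^~ w) (Z w) - t)]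
              [set w | forall i, t < X i w] =
  P' [set w | B (lifetime k (Xt^~ w) (Zt w))].
Proof.
move=> hk; set A := [set w | _] => PA res mB.
have mA : measurable A by exact: measurable_all_gt.
rewrite -(cond_measureE mA PA).
rewrite [X in _ X = _](_ : _ =
    [set w | B (lifetime k (fun i => X i w - t) (Z w))]); last first.
  by apply/seteqP; split => w /=; rewrite lifetimeB.
apply: (@eq_law_lifetime _ _ _ _ _ _ _ _ (fun i w => X i w - t) Z Xt Zt) => //.
  by move=> i; exact: measurable_funB.
move=> x z; rewrite (cond_measureE mA PA) -[RHS]/(reliability Xt Zt x z) res.
congr (P _ / _)%E; apply/seteqP; split => w /=.
  move=> [[xX zZ] tX]; split => // i; rewrite gt_max tX/=.
  by rewrite -ltrBrDr xX.
move=> [xX zZ]; split; [split=> // i|move=> i]; have := xX i.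
  by rewrite gt_max -ltrBrDr => /andP[].
by rewrite gt_max => /andP[].
Qed.

(** * Independence and conditioning on survival *)

Lemma big_option (S : Type) (idx : S) (op : Monoid.com_law idx) (I : finType)
    (F : option I -> S) :
  \big[op/idx]_o F o = op (F None) (\big[op/idx]_i F (Some i)).
Proof.
rewrite (bigD1 None)//=; congr (op _ _).
rewrite (reindex_omap Some id) => [|[i|]]//=.
by apply: eq_bigl => i; rewrite eqxx.
Qed.

Lemma prode_div (R : realType) (I : finType) (a b : I -> \bar R) :
  (forall i, 0 < b i < +oo)%E ->
  (\prod_i (a i / b i) = (\prod_i a i) / \prod_i b i)%E.
Proof.
move=> b0; rewrite big_split/=; congr (_ * _)%E.
suff [] : (\prod_i (b i)^-1 = (\prod_i b i)^-1)%E /\ (0 < \prod_i b i < +oo)%E by [].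
(* Inversion of an extended real product is multiplicative for positive finite factors, so the
   induction carries these bounds along. *)
pose K (x y : \bar R) := (x = y^-1 /\ 0 < y < +oo)%E.
apply: (big_ind2 K) => [|x1 x2 y1 y2|i _]; rewrite /K; last by rewrite b0.
  by rewrite inve1 lte01 ltry.
move=> [-> /andP[x0 xoo]] [-> /andP[y0 yoo]]; split.
  by rewrite inveM// fin_inveM_def// ?gt_eqF// ge0_fin_numE// ltW.
by rewrite mule_gt0//= lte_mul_pinfty// ?ge0_fin_numE// ltW.
Qed.

Section Independence.
Context {R : realType} {n : nat} d (T : measurableType d) (P : probability T R).
Variables (X : 'I_n -> {RV P >-> R}) (Z : {RV P >-> R}).

Lemma mutually_independent_adjoinP : mutually_independent (adjoin X Z) <->
  forall (B : 'I_n -> set R) (C : set R),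
    (forall i, measurable (B i)) -> measurable C ->
    P [set w | (forall i, B i (X i w)) /\ C (Z w)] =
    (P (Z @^-1` C) * \prod_i P (X i @^-1` B i))%E.
Proof.
split=> [indep B C mB mC|indep J B mB].
  pose BC o := if o is Some i then B i else C.
  have mBC o : measurable (BC o) by case: o.
  have := indep finset.setT BC mBC.
  rewrite (eq_bigl predT) => [|o]; last by rewrite inE.
  rewrite big_option/= => <-; congr (P _); apply/seteqP; split => w /=.
    by move=> [BX CZ] [i|] _; [exact: BX|exact: CZ].
  by move=> h; split => [i|]; [exact: (h (Some i))|exact: (h None)].
(* Allowing the whole line at indices outside [J] keeps the event and inserts factors equal to 1,
   which reduces any subfamily to the full family. *)
pose B' o := if o \in J then B o else setT.
have mB' o : measurable (B' o) by rewrite /B'; case: ifP.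
rewrite big_mkcond/=.
transitivity (\prod_o P (adjoin X Z o @^-1` B' o))%E; last first.
  apply: eq_bigr => o _; rewrite /B'; case: ifP => // _.
  by rewrite preimage_setT probability_setT.
rewrite big_option/= -indep//; congr (P _); apply/seteqP; split => w /= h.
  split => [i|]; rewrite /B'; case: ifP => //; first exact: (h (Some i)).
  exact: (h None).
case: h => hX hZ [i|] oJ /=; [have := hX i|have := hZ]; by rewrite /B' oJ.
Qed.

Hypothesis indep : mutually_independent (adjoin X Z).

Lemma independent_probabilityE (B : 'I_n -> set R) :
  (forall i, measurable (B i)) ->
  P [set w | forall i, B i (X i w)] = (\prod_i P (X i @^-1` B i))%E.
Proof.
move=> mB; have := mutually_independent_adjoinP.1 indep B setT mB measurableT.
rewrite preimage_setT probability_setT mul1e => <-.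
by congr (P _); apply/seteqP; split => w //= [].
Qed.

Variable t : R.
Hypothesis PA : (0 < P [set w | forall i, (t < X i w)%R])%E.

Lemma probability_gt0 i : (0 < P [set w | (t < X i w)%R] < +oo)%E.
Proof.
rewrite -ge0_fin_numE// fin_num_measure ?andbT; last exact: measurable_gt.
apply: lt_le_trans PA _; apply: le_measure; rewrite ?inE; last by move=> w /=.
- exact: measurable_all_gt.
- exact: measurable_gt.
Qed.

(** The conditioning event is itself a product event, so numerator and denominator both factor and
    the quotient splits coordinate by coordinate. *)
Lemma cond_prob_independent (B : 'I_n -> set R) :
  (forall i, measurable (B i)) ->
  cond_prob P [set w | forall i, B i (X i w)] [set w | forall i, t < X i w] =
  (\prod_i cond_prob P (X i @^-1` B i) [set w | (t < X i w)%R])%E.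
Proof.
move=> mB; rewrite /cond_prob prode_div; last exact: probability_gt0.
have mt : measurable [set y : R | t < y] by exact: measurable_gt.
have -> : [set w | forall i, B i (X i w)] `&` [set w | forall i, t < X i w] =
    [set w | forall i, (B i `&` [set y | t < y]) (X i w)].
  apply/seteqP; split => w /=; first by move=> [BX tX].
  by move=> h; split => i; have [] := h i.
rewrite (@independent_probabilityE (fun i => B i `&` [set y | t < y])); last first.
  by move=> i; exact: measurableI.
by rewrite (@independent_probabilityE (fun=> [set y | t < y])).
Qed.

Lemma cond_prob_independent1 i (B : set R) : measurable B ->
  cond_prob P (X i @^-1` B) [set w | forall i, t < X i w] =
  cond_prob P (X i @^-1` B) [set w | t < X i w].
Proof.
move=> mB; pose B' j := if j == i then B else setT.
have XB : X i @^-1` B = [set w | forall j, B' j (X j w)].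
  apply/seteqP; split => w /=; last by move=> /(_ i); rewrite /B' eqxx.
  by move=> BX j; rewrite /B'; case: eqP => // ->.
rewrite [in LHS]XB cond_prob_independent; last by move=> j; rewrite /B'; case: ifP.
(* For [j] other than [i] the factor is the conditional probability of the whole line, that is 1. *)
rewrite (bigD1 i)//= big1 ?mule1 => [|j ji]; last first.
  rewrite /B' (negbTE ji) preimage_setT /cond_prob setTI divee//.
    by have /andP[_] := probability_gt0 j; rewrite -ge0_fin_numE.
  by have /andP[? _] := probability_gt0 j; rewrite gt_eqF.
by rewrite /B' eqxx.
Qed.

End Independence.

(** * Residual lifetimes of independent components *)

Section IndependentResidual.
Context {R : realType} {n : nat} d (T : measurableType d) (P : probability T R).
Variables (X : 'I_n -> {RV P >-> R}) (Z : {RV P >-> R}) (t : R).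
Hypothesis indep : mutually_independent (adjoin X Z).
Hypothesis PA : (0 < P [set w | forall i, (t < X i w)%R])%E.

(** The two events are nested: for positive [x] survival past [x + t] implies survival past [t], and
    otherwise the inclusion is reversed and the ratio is 1. *)
Lemma cond_prob_gt_shift i (x : R) :
  cond_prob P [set w | x + t < X i w] [set w | t < X i w] =
  (if (0 < x)%R then ccdf (X i) (x + t)%R / ccdf (X i) t else 1)%E.
Proof.
have ccdfE y : ccdf (X i) y = P [set w | y < X i w].
  by congr (P _); apply/seteqP; split => w /=; rewrite in_itv/= andbT.
have /andP[p0 pf] := probability_gt0 PA i.
rewrite /cond_prob !ccdfE; case: ltP => x0.
  congr (P _ / _)%E; apply/seteqP; split => w /=; first by case.
  move=> xt; split => //; apply: lt_trans xt.
  by rewrite ltrDr.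
rewrite (_ : _ `&` _ = [set w | t < X i w]).
  by rewrite divee ?gt_eqF// ge0_fin_numE.
apply/seteqP; split => w /=; first by case.
move=> tX; split => //; apply: le_lt_trans tX.
by rewrite gerDr.
Qed.

Lemma independent_residual_reliability d' (T' : measurableType d')
    (P' : probability T' R) (Xt : 'I_n -> {RV P' >-> R}) (Zt : {RV P' >-> R}) :
  mutually_independent (adjoin Xt Zt) ->
  (forall i x, P' [set w | x < Xt i w] =
    cond_prob P [set w | x + t < X i w] [set w | t < X i w]) ->
  (forall B, measurable B -> P' (Zt @^-1` B) = P (Z @^-1` B)) ->
  has_residual_reliability t X Z Xt Zt.
Proof.
move=> indept Xtt ZtZ x z.
pose ray (c : R) := [set y : R | c < y].
have mray c : measurable (ray c) by exact: measurable_gt.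
have relt : reliability Xt Zt x z =
    (P' (Zt @^-1` ray z) * \prod_i P' (Xt i @^-1` ray (x i)))%E.
  by apply: (mutually_independent_adjoinP Xt Zt).1.
have rel : reliability X Z (fun i => Num.max t (x i + t)) z =
    (P (Z @^-1` ray z) *
     \prod_i P (X i @^-1` ray (Num.max t (x i + t)%R)))%E.
  by apply: (mutually_independent_adjoinP X Z).1.
(* The factor of [Z] is common to both sides; what remains is a quotient of products, to be matched
   factor by factor. *)
rewrite relt rel ZtZ// -muleA; congr (_ * _)%E.
rewrite (@independent_probabilityE _ _ _ _ _ X Z indep (fun=> ray t))//.
rewrite -prode_div; last exact: probability_gt0.
apply: eq_bigr => i _; rewrite -[LHS]/(P' [set w | x i < Xt i w]) Xtt.
congr (P _ / _)%E; apply/seteqP; split => w;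
  rewrite /ray /= gt_max.
  by move=> [-> ->].
by move=> /andP[].
Qed.

(* The product of P with its conditioning on {X_{1:n} > t} carries an unchanged
   copy of Z on the first factor and the residual lifetimes on the second. *)
Lemma exists_independent_residual :
  exists (d' : measure_display) (T' : measurableType d') (P' : probability T' R)
    (phi : {mfun T' >-> T}) (Xt : 'I_n -> {RV P' >-> R}) (Zt : {RV P' >-> R}),
  [/\ forall C : set T, measurable C -> P' (phi @^-1` C) = P C,
      forall w, Zt w = Z (phi w),
      mutually_independent (adjoin Xt Zt) &
      forall i x, P' [set w | x < Xt i w] =
        cond_prob P [set w | x + t < X i w] [set w | t < X i w]].
Proof.
have mA : measurable [set w | forall i, t < X i w] by exact: measurable_all_gt.
pose Q := cond_measure P mA.
pose P' : probability (T * T)%type R := (P \x Q)%E.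
have P'E A1 A2 : measurable A1 -> measurable A2 ->
    P' (A1 `*` A2) = (P A1 * Q A2)%E by move=> *; exact: product_measure1E.
have mXt i : measurable_fun setT (fun w : T * T => X i w.2 - t).
  by apply: measurable_funB => //; exact: measurableT_comp.
have mZt : measurable_fun setT (fun w : T * T => Z w.1) by exact: measurableT_comp.
(* The first projection sends [P'] to [P], since [Q] has total mass 1. *)
pose phi : {mfun (T * T)%type >-> T} := mfun_Sub (mem_set measurable_fst).
pose Xt i : {RV P' >-> R} := mfun_Sub (mem_set (mXt i)).
pose Zt : {RV P' >-> R} := mfun_Sub (mem_set mZt).
(* This is the translate of [B] by [t]: the residual value lies in [B] exactly when the original one
   lies in [sh B]. *)
pose sh (B : set R) : set R := [set y | B (y - t)].
have msh B : measurable B -> measurable (sh B).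
  move=> mB; rewrite -[sh B]setTI.
  have mB_t : measurable_fun setT (fun y : R => y - t) by exact: measurable_funB.
  exact: mB_t.
have mXi i B : measurable B -> measurable (X i @^-1` B).
  by move=> mB; rewrite -[_ @^-1` _]setTI; exact: measurable_funP.
have mZB B : measurable B -> measurable (Z @^-1` B).
  by move=> mB; rewrite -[_ @^-1` _]setTI; exact: measurable_funP.
have XtE i B : measurable B ->
    P' (Xt i @^-1` B) = cond_prob P (X i @^-1` sh B) [set w | t < X i w].
  move=> mB; rewrite (_ : _ @^-1` _ = setT `*` (X i @^-1` sh B)); last first.
    by apply/seteqP; split => w /=; [|case].
  rewrite P'E//; last by apply: mXi; exact: msh.
  rewrite probability_setT mul1e cond_measureE//.
  (* [Q] conditions on survival of all components; independence reduces this to survival of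
     component [i]. *)
  by rewrite (cond_prob_independent1 indep)//; exact: msh.
have ZtE B : measurable B -> P' (Zt @^-1` B) = P (Z @^-1` B).
  move=> mB; rewrite (_ : _ @^-1` _ = (Z @^-1` B) `*` setT); last first.
    by apply/seteqP; split => w /=; [|case].
  by rewrite P'E//; [rewrite probability_setT mule1|exact: mZB].
exists _, (T * T)%type, P', phi, Xt, Zt; split => //.
- move=> C mC; rewrite (_ : _ @^-1` _ = C `*` setT); last first.
    by apply/seteqP; split => w /=; [|case].
  by rewrite P'E// probability_setT mule1.
- apply/mutually_independent_adjoinP => B C mB mC.
  (* The event is a rectangle, so the product measure separates [Z] from the residual lifetimes,
     whose mutual independence comes from that under conditioning. *)
  rewrite (_ : [set w | _] = (Z @^-1` C) `*`
      [set w | forall i, (sh (B i)) (X i w)]); last first.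
    by apply/seteqP; split => w /= [].
  rewrite P'E//; [|exact: mZB|].
    rewrite ZtE// cond_measureE//.
    rewrite (cond_prob_independent indep PA (B := fun i => sh (B i))); last first.
      by move=> i; exact: msh.
    by congr (_ * _)%E; apply: eq_bigr => i _; rewrite XtE.
  apply: (measurable_forall (F := fun i => X i @^-1` sh (B i))) => i.
  by apply: mXi; exact: msh.
- move=> i x; rewrite -[[set w | x < Xt i w]]/(Xt i @^-1` [set y | x < y]).
  rewrite XtE; last exact: measurable_gt.
  by congr (P (_ `&` _) / _)%E; apply/seteqP; split => w;
    rewrite /sh /= ltrBrDr.
Qed.

End IndependentResidual.

Theorem theorem3p1 (R : realType) (d : measure_display) (Omega : measurableType d)
    (P : probability Omega R) (n k : nat) (hk : (1 <= k <= n)%N)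
    (X : 'I_n -> {RV P >-> R}) (Z : {RV P >-> R}) (t : R)
    (ht : (0 < P [set w | t%:E < order_stat (fun i => X i w) 1])%E) :
  let A := [set w | (t%:E < order_stat (fun i => X i w) 1)%E] in
  let L := fun w => lifetime k (fun i => X i w) (Z w) in
  (forall (d' : measure_display) (Omega' : measurableType d')
      (P' : probability Omega' R)
      (Xt : 'I_n -> {RV P' >-> R}) (Zt : {RV P' >-> R}),
    has_residual_reliability t X Z Xt Zt ->
    let Lt := fun w => lifetime k (fun i => Xt i w) (Zt w) in
    [/\ forall B : set R, measurable B ->
          cond_prob P [set w | B (L w - t)] A = P' [set w | B (Lt w)],
        forall s : R, 0 <= s ->
          cond_prob P [set w | s < L w - t] A = P' [set w | s < Lt w] &
        integral_defined P (fun w => L w - t) A \/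
          integral_defined P' Lt setT ->
        [/\ integral_defined P (fun w => L w - t) A,
            integral_defined P' Lt setT &
            cond_expectation P (fun w => L w - t) A = ('E_P'[Lt])%E]]) /\
  (mutually_independent (adjoin X Z) ->
    let residual_prob (i : 'I_n) (x : R) :=
      cond_prob P [set w | x + t < X i w] [set w | t < X i w] in
    [/\ forall (i : 'I_n) (x : R),
          residual_prob i x =
          (if (0 < x)%R then ccdf (X i) (x + t)%R / ccdf (X i) t else 1)%E,
        (* Z itself can be kept, on an extension phi of the probability space *)
        exists (d' : measure_display) (Omega' : measurableType d')
          (P' : probability Omega' R) (phi : {mfun Omega' >-> Omega})
          (Xt : 'I_n -> {RV P' >-> R}) (Zt : {RV P' >-> R}),
          [/\ forall C : set Omega, measurable C -> P' (phi @^-1` C) = P C,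
              forall w, Zt w = Z (phi w),
              mutually_independent (adjoin Xt Zt) &
              forall (i : 'I_n) (x : R),
                P' [set w | x < Xt i w] = residual_prob i x] &
        forall (d' : measure_display) (Omega' : measurableType d')
          (P' : probability Omega' R)
          (Xt : 'I_n -> {RV P' >-> R}) (Zt : {RV P' >-> R}),
          mutually_independent (adjoin Xt Zt) ->
          (forall (i : 'I_n) (x : R),
            P' [set w | x < Xt i w] = residual_prob i x) ->
          (forall B : set R, measurable B ->
            P' (Zt @^-1` B) = P (Z @^-1` B)) ->
          has_residual_reliability t X Z Xt Zt]).
Proof.
move=> A L; have mA : measurable [set w | forall i, t < X i w].
  exact: measurable_all_gt.
have AE : A = [set w | forall i, t < X i w].
  by apply/seteqP; split => w /= /order_stat1_gt.
have PA : (0 < P [set w | forall i, (t < X i w)%R])%E by rewrite -AE.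
have mL : measurable_fun setT (fun w => L w - t).
  by apply: measurable_funB => //; exact: measurable_lifetime.
split=> [d' Omega' P' Xt Zt res Lt|indep residual_prob].
  have mLt : measurable_fun setT Lt by exact: measurable_lifetime.
  have law B : measurable B ->
      cond_prob P [set w | B (L w - t)] A = P' [set w | B (Lt w)].
    by move=> mB; rewrite AE; exact: has_residual_reliability_lifetime.
  split; first exact: law.
    move=> s _; apply: (law [set y | s < y]); exact: measurable_gt.
  (* The equality of laws on all Borel sets is exactly what the transfer of expectations
     requires. *)
  rewrite AE in law *; exact: cond_expectation_eq_law.
split.
- exact: cond_prob_gt_shift.
- exact: exists_independent_residual.
- by move=> d' Omega' P' Xt Zt; exact: independent_residual_reliability.
Qed.
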